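(* For every $\epsilon\in(0,1/2]$ there exist constants $C_\epsilon>0$ and $C>0$ depending only on $\epsilon$ such that the following holds for all $n,T\ge 2$, all $\omega_n>0$, all $\tau\in\{1,\dots,T-1\}$ and all $\alpha,\beta\in(0,1)$. Let $$H_{\alpha,n}=2\sqrt2(1+\epsilon)\sqrt{\omega_n}+C_\epsilon\log\Bigl(\frac{2n}{\alpha}\Bigr),\qquad \psi^\tau_{n,T}(Y)=\mathbf 1_{\{\|Z_T(\tau)\|_{2\to2}>H_{\alpha,n}\}} .$$ If $$\mathcal R_{n,\tau}\ \ge\ 4\sqrt2(1+\epsilon)\Bigl(\frac{\omega_n}{T}\Bigr)^{1/2}+\frac{C}{T^{1/2}}\log\Bigl(\frac{n}{\alpha\wedge\beta}\Bigr),$$ then $\alpha(\psi^\tau_{n,T})\le\alpha$ and $\beta(\psi^\tau_{n,T},\mathcal R_{n,\tau})\le\beta$.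
   Context: Notation: $\|M\|_{2\to2}$ is the operator (spectral) norm of a matrix, $\|M\|_{1,\infty}=\max_j\sum_i|M_{ij}|$, $\odot$ is the entrywise (Hadamard) product, $q(t)=\sqrt{t(1-t)}$ for $t\in[0,1]$, $a\wedge b=\min(a,b)$. Parameter sets: $\mathcal C_n$ is the set of symmetric matrices in $[0,1]^{n\times n}$; $\mathcal C_n^0$ is the subset of those with zero diagonal; for $\omega_n>0$, $\mathcal S_n(\omega_n)=\{(\Theta,\Pi)\in\mathcal C_n^0\times\mathcal C_n:\ \|\Pi\odot\Theta\|_{1,\infty}\le\omega_n\}$. Throughout, sampling matrices $\Pi$ satisfy $\Pi_{ii}=1$ and $\Pi_{ij}>0$. Model: $Y^t\sim\mathrm{IRGML}(\Theta^t,\Pi)$ means that $Y^t$ is the symmetric $\{0,1\}$-valued $n\times n$ matrix with zero diagonal and $Y^t_{ij}=\Omega^t_{ij}A^t_{ij}$, where for $i<j$ the variables $A^t_{ij}\sim\mathrm{Bernoulli}(\Theta^t_{ij})$ and $\Omega^t_{ij}\sim\mathrm{Bernoulli}(\Pi_{ij})$ are all mutually independent. One observes $Y=(Y^1,\dots,Y^T)$, independent over $t$. Matrix CUSUM statistic: for $t=1,\dots,T-1$, $$Z_T(t)=\sqrt{\frac{t(T-t)}T}\Bigl(\frac1t\sum_{s=1}^tY^s-\frac1{T-t}\sum_{s=t+1}^TY^s\Bigr).$$ Hypotheses and errors (problem of testing for a change at a given time $\tau$): $\mathrm P_{(\Theta^0,\Pi)}$ is the law of $Y$ when $\Theta^t=\Theta^0$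 for all $t$. $\mathrm P^\tau_{\Theta^a,\Theta^b,\Pi}$ is the law of $Y$ when $\Theta^t=\Theta^a$ for $t\le\tau$ and $\Theta^t=\Theta^b$ for $t>\tau$. For $r>0$, $\mathcal W^\tau_{n,T}(\omega_n,r)$ is the set of all $\{(\Theta^a,\Pi),(\Theta^b,\Pi)\}$ with both pairs in $\mathcal S_n(\omega_n)$ and $q(\tau/T)\|\Pi\odot(\Theta^a-\Theta^b)\|_{2\to2}\ge r$. For a test $\psi$ (a measurable $\{0,1\}$-valued function of $Y$), the type I error is $\alpha(\psi)=\sup_{(\Theta^0,\Pi)\in\mathcal S_n(\omega_n)}\mathrm P_{(\Theta^0,\Pi)}\{\psi=1\}$ and the type II error at radius $r$ is $\beta(\psi,r)=\sup_{\{(\Theta^a,\Pi),(\Theta^b,\Pi)\}\in\mathcal W^\tau_{n,T}(\omega_n,r)}\mathrm P^\tau_{\Theta^a,\Theta^b,\Pi}\{\psi=0\}$. *)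

(* Defs.v *)
(* MathComp-Analysis; [R : realType] plays the role of the real numbers. *)
From HB Require Import structures.
From mathcomp Require Import all_boot all_order all_algebra.
From mathcomp Require Import all_classical all_reals all_analysis.

Set Implicit Arguments.
Unset Strict Implicit.
Unset Printing Implicit Defensive.

Import Order.TTheory GRing.Theory Num.Theory.
Local Open Scope classical_set_scope.
Local Open Scope ring_scope.

Section MatrixNorms.
Context {R : realType}.

Definition l2norm m (x : 'cV[R]_m) : R := Num.sqrt (\sum_i x i ord0 ^+ 2).

(* The norm [`|M|] that MathComp-Analysis puts on matrices is the entrywise
   maximum; this is the operator norm between Euclidean spaces. *)
Definition opnorm m n (M : 'M[R]_(m, n)) : R :=
  sup [set l2norm (M *m x) | x in [set x : 'cV[R]_n | l2norm x <= 1]].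

Definition norm_1inf m n (M : 'M[R]_(m, n)) : R :=
  \big[Num.max/0]_(j < n) \sum_(i < m) `|M i j|.

Definition hadamard m n (A B : 'M[R]_(m, n)) : 'M[R]_(m, n) :=
  map2_mx *%R A B.

Lemma l2norm_coord m (x : 'cV[R]_m) i : `|x i ord0| <= l2norm x.
Proof.
rewrite /l2norm -sqrtr_sqr ler_wsqrtr// (bigD1 i)//= lerDl.
by apply: sumr_ge0 => j _; rewrite sqr_ge0.
Qed.

(* The supremum defining [opnorm] is never degenerate. *)
Lemma opnorm_has_sup m n (M : 'M[R]_(m, n)) :
  has_sup [set l2norm (M *m x) | x in [set x : 'cV[R]_n | l2norm x <= 1]].
Proof.
split.
  exists (l2norm (M *m 0)), 0 => //=.
  rewrite /l2norm big1 ?sqrtr0// => i _.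
  by rewrite mxE expr0n.
exists (Num.sqrt (\sum_i (\sum_j `|M i j|) ^+ 2)) => _ [x /= x1 <-].
rewrite /l2norm ler_wsqrtr//; apply: ler_sum => i _.
rewrite -real_normK ?num_real// lerXn2r ?nnegrE//.
  by apply: sumr_ge0 => j _.
rewrite mxE; apply: (le_trans (ler_norm_sum _ _ _)).
apply: ler_sum => j _; rewrite normrM -[leRHS]mulr1 ler_wpM2l//.
exact: le_trans (l2norm_coord _ _) x1.
Qed.

End MatrixNorms.

Section ParamSets.
Context {R : realType}.

Definition qfun (t : R) : R := Num.sqrt (t * (1 - t)).

Definition connection_mx n : set 'M[R]_n :=
  [set M | M^T = M /\ forall i j, 0 <= M i j <= 1].

Definition connection_mx0 n : set 'M[R]_n :=
  [set M | connection_mx M /\ forall i, M i i = 0].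

Definition sampling_mx n : set 'M[R]_n :=
  [set P | [/\ connection_mx P, forall i, P i i = 1 & forall i j, 0 < P i j]].

(* Pairs (Theta, Pi); Pi is a sampling matrix throughout. *)
Definition param_set n (omega : R) : set ('M[R]_n * 'M[R]_n) :=
  [set p | [/\ connection_mx0 p.1, sampling_mx p.2
             & norm_1inf (hadamard p.2 p.1) <= omega]].

(* Triples (Theta^a, Theta^b, Pi). *)
Definition alternatives n (T : nat) (tau : nat) (omega r : R)
    : set ('M[R]_n * 'M[R]_n * 'M[R]_n) :=
  [set p | let: (Ta, Tb, P) := p in
     [/\ param_set omega (Ta, P), param_set omega (Tb, P)
       & r <= qfun (tau%:R / T%:R) * opnorm (hadamard P (Ta - Tb))]].

End ParamSets.

Section Model.
Context {R : realType}.

(* Joint mass function of mutually independent Bernoulli(p i) variables. *)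
Definition bernoulli_prod_pmf (I : finType) (p : I -> R)
    (w : {ffun I -> bool}) : R :=
  \prod_i bernoulli_pmf (p i) (w i).

Lemma bernoulli_prod_pmf_indep (I : finType) (p : I -> R) (B : I -> pred bool) :
  \sum_(w : {ffun I -> bool} | [forall i, B i (w i)]) bernoulli_prod_pmf p w
  = \prod_i \sum_(b | B i b) bernoulli_pmf (p i) b.
Proof.
rewrite bigA_distr_big_dep/=; apply: eq_bigl => w.
by apply/forallP/familyP.
Qed.

Lemma bernoulli_prod_pmf_sum1 (I : finType) (p : I -> R) :
  \sum_w bernoulli_prod_pmf p w = 1.
Proof.
rewrite (eq_bigl (fun w : {ffun I -> bool} => [forall i, xpredT (w i)])).
  rewrite (bernoulli_prod_pmf_indep p (fun=> xpredT)) big1// => i _.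
  by rewrite big_bool/= addrC subrK.
by move=> w; symmetry; apply/forallP.
Qed.

Definition edge n := {e : 'I_n * 'I_n | (e.1 < e.2)%N}.

(* The symmetric matrix with zero diagonal and upper-triangular entries f. *)
Definition sym_of_edges n (f : edge n -> bool) : 'M[bool]_n :=
  \matrix_(i, j) (oapp f false (insub (i, j)) || oapp f false (insub (j, i))).

(* The left summand indexes the A_ij, the right one the Omega_ij. *)
Definition coin_prob n (Theta P : 'M[R]_n) (k : edge n + edge n) : R :=
  match k with
  | inl e => Theta (val e).1 (val e).2
  | inr e => P (val e).1 (val e).2
  end.

Definition observed_mx n (w : {ffun edge n + edge n -> bool}) : 'M[bool]_n :=
  sym_of_edges (fun e => w (inr e) && w (inl e)).

Definition irgml_pmf n (Theta P : 'M[R]_n) (y : 'M[bool]_n) : R :=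
  \sum_(w | observed_mx w == y) bernoulli_prod_pmf (coin_prob Theta P) w.

Definition obs n T := {ffun 'I_T -> 'M[bool]_n}.

(* Y^1, ..., Y^T are independent with Y^t ~ IRGML(Theta^t, Pi). *)
Definition obs_prob n T (Theta : 'I_T -> 'M[R]_n) (P : 'M[R]_n)
    (E : pred (obs n T)) : R :=
  \sum_(Y : obs n T | E Y) \prod_t irgml_pmf (Theta t) P (Y t).

Definition prob_null n T (Theta0 P : 'M[R]_n) : pred (obs n T) -> R :=
  obs_prob (fun=> Theta0) P.

(* The ordinal t : 'I_T stands for time t + 1, so that t < tau means
   that this time is at most tau. *)
Definition prob_alt n T (tau : nat) (Ta Tb P : 'M[R]_n) : pred (obs n T) -> R :=
  obs_prob (fun t : 'I_T => if (t < tau)%N then Ta else Tb) P.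

Lemma irgml_pmf_sum1 n (Theta P : 'M[R]_n) : \sum_y irgml_pmf Theta P y = 1.
Proof.
rewrite -[RHS](bernoulli_prod_pmf_sum1 (coin_prob Theta P)).
by rewrite [RHS](partition_big (@observed_mx n) xpredT).
Qed.

Lemma irgml_pmf_ge0 n (Theta P : 'M[R]_n) y :
  connection_mx Theta -> connection_mx P -> 0 <= irgml_pmf Theta P y.
Proof.
move=> [_ hT] [_ hP]; apply: sumr_ge0 => w _; apply: prodr_ge0 => k _.
by apply: bernoulli_pmf_ge0; case: k => e /=.
Qed.

Lemma obs_probT n T (Theta : 'I_T -> 'M[R]_n) P : obs_prob Theta P xpredT = 1.
Proof.
rewrite /obs_prob -(bigA_distr_bigA (fun t y => irgml_pmf (Theta t) P y)).
by rewrite big1// => t _; exact: irgml_pmf_sum1.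
Qed.

Lemma obs_prob_ge0_le1 n T (Theta : 'I_T -> 'M[R]_n) P (E : pred (obs n T)) :
  (forall t, connection_mx (Theta t)) -> connection_mx P ->
  0 <= obs_prob Theta P E <= 1.
Proof.
move=> hT hP.
have pmf_ge0 (Y : obs n T) : 0 <= \prod_t irgml_pmf (Theta t) P (Y t).
  by apply: prodr_ge0 => t _; exact: irgml_pmf_ge0.
apply/andP; split; first exact: sumr_ge0.
rewrite -(obs_probT Theta P) /obs_prob (bigID E xpredT)/= lerDl.
exact: sumr_ge0.
Qed.

End Model.

Section Testing.
Context {R : realType}.

Definition real_mx n (y : 'M[bool]_n) : 'M[R]_n :=
  map_mx (fun b : bool => b%:R) y.

Definition cusum n T (Y : obs n T) (t : nat) : 'M[R]_n :=
  Num.sqrt (t%:R * (T - t)%:R / T%:R) *: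
    ((t%:R)^-1 *: (\sum_(s < T | (s < t)%N) real_mx (Y s))
     - ((T - t)%:R)^-1 *: (\sum_(s < T | (t <= s)%N) real_mx (Y s))).

(* Every function on the finite observation space is measurable. *)
Definition test n T := obs n T -> bool.

(* The suprema below are of sets of probabilities, hence bounded by 1; on an
   empty set of alternatives [sup] is 0. *)
Definition typeI_error n T (omega : R) (psi : test n T) : R :=
  sup [set prob_null p.1 p.2 (fun Y => psi Y) | p in @param_set R n omega].

Definition typeII_error n T (tau : nat) (omega r : R) (psi : test n T) : R :=
  sup [set prob_alt tau p.1.1 p.1.2 p.2 (fun Y => ~~ psi Y)
      | p in @alternatives R n T tau omega r].

Definition threshold (eps Ceps omega alpha : R) (n : nat) : R :=
  2 * Num.sqrt 2 * (1 + eps) * Num.sqrt omega + Ceps * ln (2 * n%:R / alpha).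

Definition cusum_test n T (tau : nat) (H : R) : test n T :=
  fun Y => H < opnorm (cusum Y tau).

End Testing.

(* Main.v *)
(** Let S be the CUSUM matrix, M its mean and S' an independent copy of S. By
convexity, E |S - M|^N <= E |S - S'|^N <= E tr (S - S')^N for even N = 2p. The
entries of S - S' are sums of independent symmetric variables xi_i, bounded by 1,
one for each label i = (time, edge), so the trace is a sum over closed walks in a
multigraph in which every label is used an even number of times. A step opens its
label or closes it, according to the parity of the earlier uses. At a vertex
with d open labels there are d ways to close one; these factors are absorbed by
a potential built from double factorials, at the price of a factor 1 + d' for
opening a label towards a vertex with d' open labels. The opening steps then
have total weight at most 2 omega + O(N^2), and walks with p openings and p
closings give E tr (S - S')^(2p) <= n (4 (2 omega + O(p^2)))^p. Markov's inequality
with p of order log (2 n / delta) yields the tail bound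
2 sqrt 2 (1 + eps) sqrt omega + C log (2 n / delta), which gives both errors since
M is 0 under the null hypothesis and has norm
sqrt T q(tau / T) |P o (Ta - Tb)| under the alternative. *)
Require Import Defs.
From HB Require Import structures.
From mathcomp Require Import all_boot all_order all_algebra.
From mathcomp Require Import all_classical all_reals all_analysis.
From mathcomp Require Import zify ring lra.
Set Implicit Arguments.
Unset Strict Implicit.
Unset Printing Implicit Defensive.
Import Order.TTheory GRing.Theory Num.Theory.
Local Open Scope ring_scope.

(** * Weighted walks in a multigraph and their potential *)

Fixpoint dfact (n : nat) : nat := if n is n'.+2 then (n * dfact n')%N else 1%N.

(** Truncated predecessors encode the convention (-1)!! = 1, so a vertex of degree 0 needs no
    separate treatment. *)
Lemma dfact_pred_succ (n : nat) : dfact n.+1 = (n.+1 * dfact n.-1)%N.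
Proof. by case: n. Qed.

Lemma dfact_le_pred (n : nat) : (n * dfact n.-2 <= dfact n)%N.
Proof. by case: n => [|[|n]]. Qed.

Section Walks.
Variables (R : realFieldType) (V I : finType) (a b : I -> V).
Hypothesis neq_ends : forall i, a i != b i.

Definition incident (x : V) (i : I) : bool := (x == a i) || (x == b i).
(** Meaningful for an incident [x] only; elsewhere the value [a i] is a default. *)
Definition opposite (x : V) (i : I) : V := if x == a i then b i else a i.
Definition incr (m : I -> nat) (i : I) : I -> nat := fun j => (m j + (j == i))%N.
Definition odd_deg (m : I -> nat) (x : V) : nat := \sum_(i | incident x i) odd (m i).
Definition odd_count (m : I -> nat) : nat := \sum_i odd (m i).

(* The labels with odd multiplicity are open. The current vertex x carries
   (deg x)!! and any other vertex z carries (deg z - 1)!!: a closing step at x then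
   divides the potential by at least deg x, the number of ways to close. *)
Definition pot (x : V) (m : I -> nat) : nat :=
  (dfact (odd_deg m x) * \prod_(z | z != x) dfact (odd_deg m z).-1)%N.

Lemma opposite_neq x i : incident x i -> opposite x i != x.
Proof.
rewrite /incident /opposite; case: eqP => [-> _|_ /= /eqP ->]; last exact: neq_ends.
by rewrite eq_sym.
Qed.

Lemma opposite_incident x i : incident (opposite x i) i.
Proof. by rewrite /incident /opposite; case: ifP; rewrite eqxx ?orbT. Qed.

Lemma opposite_sym x y i :
  incident x i && (opposite x i == y) = incident y i && (opposite y i == x).
Proof.
have invol z : incident z i -> opposite (opposite z i) i = z.
  rewrite /incident /opposite; case: (z =P a i) => [->|_ /= /eqP ->]; last by rewrite eqxx.
  by rewrite [b i == _]eq_sym (negPf (neq_ends i)).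
by apply/andP/andP => -[inc /eqP <-]; rewrite opposite_incident invol.
Qed.

Lemma incident_cases x i z :
  incident x i -> z != x -> z != opposite x i -> incident z i = false.
Proof.
rewrite /incident /opposite; case: (x =P a i) => [->|_ /= /eqP ->] //=.
  by move=> _ /negPf-> /negPf->.
by move=> /negPf-> /negPf->.
Qed.

Lemma odd_deg_incr_notin m i z : ~~ incident z i ->
  odd_deg (incr m i) z = odd_deg m z.
Proof.
move=> zi; apply: eq_bigr => j zj; rewrite /incr.
by case: eqP zi zj => [->/negPf->|] //; rewrite addn0.
Qed.

Lemma odd_deg_incr_in m i z : incident z i ->
  (odd_deg (incr m i) z + odd (m i) = odd_deg m z + ~~ odd (m i))%N.
Proof.
move=> zi; rewrite /odd_deg (bigD1 i)//= [in RHS](bigD1 i)//=.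
rewrite /incr eqxx addn1 /= -!addnA [LHS]addnC [in RHS]addnC -!addnA; congr (_ + _)%N.
  by apply: eq_bigr => j /andP[_ /negPf->]; rewrite addn0.
by rewrite addnC.
Qed.

Lemma odd_deg_open m i z : incident z i -> ~~ odd (m i) ->
  odd_deg (incr m i) z = (odd_deg m z).+1.
Proof. by move=> zi mi; have := odd_deg_incr_in m zi; rewrite (negPf mi); lia. Qed.

Lemma odd_deg_close m i z : incident z i -> odd (m i) ->
  odd_deg m z = (odd_deg (incr m i) z).+1.
Proof. by move=> zi mi; have := odd_deg_incr_in m zi; rewrite mi; lia. Qed.

Lemma odd_count_incr m i :
  (odd_count (incr m i) + odd (m i) = odd_count m + ~~ odd (m i))%N.
Proof.
rewrite /odd_count (bigD1 i)//= [in RHS](bigD1 i)//=.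
rewrite /incr eqxx addn1 /= -!addnA [LHS]addnC [in RHS]addnC -!addnA; congr (_ + _)%N.
  by apply: eq_bigr => j /negPf->; rewrite addn0.
by rewrite addnC.
Qed.

Lemma sum_incr m i : (\sum_j incr m i j = (\sum_j m j).+1)%N.
Proof.
rewrite /incr big_split/= -addn1; congr (_ + _)%N.
by rewrite (bigD1 i)//= eqxx big1 ?addn0// => j /negPf->.
Qed.

Lemma potD1 x y m : x != y ->
  pot x m = (dfact (odd_deg m x) * dfact (odd_deg m y).-1
             * \prod_(z | (z != x) && (z != y)) dfact (odd_deg m z).-1)%N.
Proof. by move=> xy; rewrite /pot (bigD1 y)/= 1?eq_sym// mulnA. Qed.

Lemma pot_rest x i m : incident x i ->
  (\prod_(z | (z != opposite x i) && (z != x)) dfact (odd_deg (incr m i) z).-1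
   = \prod_(z | (z != x) && (z != opposite x i)) dfact (odd_deg m z).-1)%N.
Proof.
move=> xi; apply: eq_big => [z|z /andP[zy zx]]; first by rewrite andbC.
by rewrite odd_deg_incr_notin// (incident_cases xi).
Qed.

(** Let d and d' be the open degrees at [x] and at the opposite vertex. The product d!! (d'-1)!!
    becomes (d-2)!! (d'-1)!!: the opposite degree drops by one just as that vertex becomes the
    current one. *)
Lemma pot_close x i m : incident x i -> odd (m i) ->
  (odd_deg m x * pot (opposite x i) (incr m i) <= pot x m)%N.
Proof.
move=> xi mi; have yx := opposite_neq xi.
rewrite (@potD1 (opposite x i) x)// (@potD1 x (opposite x i)) 1?eq_sym// pot_rest//.
rewrite !mulnA leq_mul2r; apply/orP; right.
rewrite mulnAC leq_mul//; last by rewrite (odd_deg_close (opposite_incident x i) mi).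
apply: leq_trans (dfact_le_pred _).
by rewrite (odd_deg_close xi mi).
Qed.

(** In the same notation d!! (d'-1)!! becomes d!! (d'+1)!!: the old vertex stops being current just
    as its degree grows. *)
Lemma pot_open x i m : incident x i -> ~~ odd (m i) ->
  pot (opposite x i) (incr m i) = (pot x m * (odd_deg m (opposite x i)).+1)%N.
Proof.
move=> xi mi; have yx := opposite_neq xi.
rewrite (@potD1 (opposite x i) x)// (@potD1 x (opposite x i)) 1?eq_sym// pot_rest//.
rewrite odd_deg_open ?opposite_incident// odd_deg_open// dfact_pred_succ /=.
by rewrite [RHS]mulnC !mulnA; congr (_ * _)%N; rewrite mulnAC.
Qed.

Lemma pot_even x m : (forall i, ~~ odd (m i)) -> pot x m = 1%N.
Proof.
move=> mE; have d0 z : odd_deg m z = 0%N.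
  by rewrite /odd_deg big1// => i _; rewrite (negPf (mE i)).
by rewrite /pot d0 /= big1// => z _; rewrite d0.
Qed.

Lemma odd_deg_le m x : (odd_deg m x <= \sum_i m i)%N.
Proof.
rewrite [leqRHS](bigID (incident x))/=; apply: leq_trans (leq_addr _ _).
by apply: leq_sum => i _; case: (m i) => // k; case: odd.
Qed.

Lemma sum_odd_deg_le m : (\sum_x odd_deg m x <= 2 * \sum_i m i)%N.
Proof.
rewrite /odd_deg (exchange_big_dep xpredT)//= mulnC big_distrl/=.
apply: leq_sum => i _; rewrite sum_nat_const mulnC leq_mul//.
  by case: (m i) => // k; case: odd.
apply: leq_trans (_ : #|[set a i; b i]| <= _)%N; last by rewrite cards2; case: eqP.
by apply/subset_leq_card/fintype.subsetP => x; rewrite !inE.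
Qed.

Variables (mu : I -> nat -> R) (w : I -> R) (s : R) (N : nat) (A B : R).
Hypothesis mu_ge0 : forall i k, 0 <= mu i k.
Hypothesis mu0 : forall i, mu i 0%N = 1.
Hypothesis mu_odd : forall i k, odd k -> mu i k = 0.
Hypothesis mu_le : forall i k, (0 < k)%N -> mu i k <= w i.
Hypothesis w_ge0 : forall i, 0 <= w i.
Hypothesis w_row : forall x, \sum_(i | incident x i) w i <= A.
Hypothesis w_pair : forall x y,
  \sum_(i | incident x i && (opposite x i == y)) w i <= B.
Hypothesis s_gt0 : 0 < s.
Hypothesis s2_ge : A + B * (2 * N)%:R + (N * N.+1)%:R <= s ^+ 2.

(** A label pays [w i] once, at its first use, because [w i] bounds every moment of positive
    order. *)
Definition weight (m : I -> nat) : R := \prod_i (if m i == 0%N then 1 else w i).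

(* Expectation of [\prod_i xi_i ^+ m i * (D ^+ k) x z], see [walk_sumE]: the sum
   over walks of k more steps from x to z after label i has been used m i times. *)
Fixpoint walk_sum (z : V) (k : nat) (x : V) (m : I -> nat) : R :=
  if k is k'.+1 then
    \sum_(i | incident x i) walk_sum z k' (opposite x i) (incr m i)
  else (x == z)%:R * \prod_i mu i (m i).

Lemma weight_ge0 m : 0 <= weight m.
Proof. by apply: prodr_ge0 => i _; case: ifP. Qed.

Lemma weight_incr m i :
  weight (incr m i) = weight m * (if m i == 0%N then w i else 1).
Proof.
rewrite /weight (bigD1 i)//= [in RHS](bigD1 i)//= {1}/incr eqxx addn1/=.
rewrite (eq_bigr (fun j => if m j == 0%N then 1 else w j)).
  by case: ifP => _; rewrite ?mul1r ?mulr1 mulrC.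
by move=> j /negPf ji; rewrite /incr ji addn0.
Qed.

(** The three terms of [s2_ge] account for fresh labels ([A]), the degree factor of fresh labels
    ([B] times 2N), and labels reopened after an even positive number of uses (N(N+1), there being
    at most N uses in all). *)
Lemma open_sum_le x m : (\sum_i m i <= N)%N ->
  \sum_(i | incident x i && ~~ odd (m i))
     (if m i == 0%N then w i else 1) * (odd_deg m (opposite x i)).+1%:R <= s ^+ 2.
Proof.
move=> mN; apply: le_trans s2_ge.
have B_ge0 : 0 <= B by apply: le_trans (w_pair x x); exact: sumr_ge0.
apply: (@le_trans _ _ (\sum_(i | incident x i)
  (w i + w i * (odd_deg m (opposite x i))%:R + (m i * N.+1)%:R))).
  rewrite big_mkcondr/=; apply: ler_sum => i _.
  have dN : ((odd_deg m (opposite x i)).+1 <= N.+1)%N by rewrite ltnS (leq_trans (odd_deg_le _ _)).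
  have wd : 0 <= w i * (odd_deg m (opposite x i))%:R by rewrite mulr_ge0.
  case: ifP => _; last by rewrite !addr_ge0.
  case: (m i =P 0%N) => [->|mi]; first by rewrite mul0n addr0 -natr1 mulrDr mulr1 addrC.
  rewrite mul1r; apply: (@le_trans _ _ (m i * N.+1)%:R); last by rewrite lerDr addr_ge0.
  by rewrite ler_nat; apply: leq_trans dN _; rewrite leq_pmull// lt0n; apply/eqP.
rewrite !big_split/=; apply: lerD; first apply: lerD => //.
  (* Grouping by the vertex reached: each group has weight at most [B], and the open degrees add up
     to at most 2N since a label has two ends. *)
  rewrite (partition_big (opposite x) xpredT)//=.
  apply: (@le_trans _ _ (\sum_y B * (odd_deg m y)%:R)).
    apply: ler_sum => y _.
    rewrite (eq_bigr (fun i => w i * (odd_deg m y)%:R)); last by move=> i /andP[_ /eqP->].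
    by rewrite -mulr_suml ler_wpM2r.
  rewrite -mulr_sumr ler_wpM2l// -natr_sum ler_nat.
  by rewrite (leq_trans (sum_odd_deg_le m))// leq_mul.
rewrite -natr_sum ler_nat -big_distrl leq_mul//=.
by apply: leq_trans mN; rewrite [leqRHS](bigID (incident x))/= leq_addr.
Qed.

(* Closing and opening steps each contribute at most half of the factor 2 s. *)
Lemma walk_sum_le z k x m : (\sum_i m i + k <= N)%N ->
  walk_sum z k x m * s ^+ odd_count m <= weight m * (pot x m)%:R * (2 * s) ^+ k.
Proof.
elim: k x m => [|k IH] x m mkN.
  rewrite expr0 mulr1 /=.
  (* A label still open at the end contributes a vanishing odd moment; if none is open, potential
     and power of [s] are both 1. *)
  case: (pickP (fun i => odd (m i))) => [i mi|mE].
    rewrite (bigD1 i)//= mu_odd// mul0r mulr0 mul0r.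
    by rewrite mulr_ge0// weight_ge0.
  have mE' i : ~~ odd (m i) by rewrite mE.
  have -> : odd_count m = 0%N by rewrite /odd_count big1// => i _; rewrite mE.
  rewrite pot_even// expr0 !mulr1; apply: (@le_trans _ _ (\prod_i mu i (m i))).
    by rewrite ler_piMl ?prodr_ge0// lern1 leq_b1.
  apply: ler_prod => i _; rewrite mu_ge0/=.
  by case: eqP => [->|/eqP]; rewrite ?mu0// -lt0n; exact: mu_le.
have mN : (\sum_i m i <= N)%N by apply: leq_trans mkN; rewrite leq_addr.
have inN i : (\sum_j incr m i j + k <= N)%N by rewrite sum_incr addSnnS.
set W := weight m * (pot x m)%:R * (2 * s) ^+ k.
have s2_ge0 : 0 <= 2 * s by rewrite mulr_ge0// ltW.
have W_ge0 : 0 <= W by rewrite !mulr_ge0 ?weight_ge0 ?exprn_ge0.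
suff [closeP openP] :
  \sum_(i | incident x i && odd (m i))
     walk_sum z k (opposite x i) (incr m i) * s ^+ odd_count m <= W * s /\
  \sum_(i | incident x i && ~~ odd (m i))
     walk_sum z k (opposite x i) (incr m i) * s ^+ odd_count m <= W * s.
  rewrite /= mulr_suml (bigID (fun i => odd (m i)))/=.
  apply: le_trans (lerD closeP openP) _.
  by rewrite /W exprS le_eqVlt; apply/orP; left; apply/eqP; ring.
split.
  (* Closing lowers [odd_count] by one, which leaves the factor [s], and a used label brings no new
     weight. The degree factor from [pot_close] then cancels against the number of labels that can
     be closed at [x]. *)
  have cl i : incident x i && odd (m i) ->
    (odd_deg m x)%:R * (walk_sum z k (opposite x i) (incr m i) * s ^+ odd_count m) <= W * s.
    move=> /andP[xi mi]; have -> : odd_count m = (odd_count (incr m i)).+1.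
      by have := odd_count_incr m i; rewrite mi; lia.
    have := IH (opposite x i) _ (inN i); rewrite weight_incr.
    case: eqP mi => [->//|_ mi]; rewrite mulr1 => IHi.
    rewrite exprSr !mulrA (ler_wpM2r (ltW s_gt0))// -[leLHS]mulrA.
    apply: (le_trans (ler_wpM2l (ler0n _ _) IHi)).
    rewrite /W !mulrA ler_wpM2r ?exprn_ge0// -[leLHS]mulrA mulrCA.
    by rewrite ler_wpM2l ?weight_ge0// -natrM ler_nat pot_close.
  have dE : odd_deg m x = #|[pred i | incident x i && odd (m i)]|.
    by rewrite -sum1_card big_mkcondr/=; apply: eq_bigr => i _; case: odd.
  have [d0|d_gt0] := posnP (odd_deg m x).
    rewrite big_pred0 ?(mulr_ge0 W_ge0 (ltW s_gt0))// => i.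
    by have /card0_eq/(_ i) : #|[pred i | incident x i && odd (m i)]| = 0%N by rewrite -dE.
  have d_gt0' : 0 < (odd_deg m x)%:R :> R by rewrite ltr0n.
  rewrite -(ler_pM2l d_gt0') mulr_sumr.
  apply: le_trans (ler_sum _ cl) _.
  by rewrite sumr_const -dE mulr_natl.
(* Opening raises [odd_count] by one, hence the extra [s] on the left; the opening weights sum to at
   most s^2, so one factor [s] remains. *)
have op i : incident x i && ~~ odd (m i) ->
    walk_sum z k (opposite x i) (incr m i) * s ^+ odd_count m * s <=
    W * ((if m i == 0%N then w i else 1) * (odd_deg m (opposite x i)).+1%:R).
  move=> /andP[xi mi]; have oE : odd_count (incr m i) = (odd_count m).+1.
    by have := odd_count_incr m i; rewrite (negPf mi); lia.
  rewrite -mulrA -exprSr -oE.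
  apply: le_trans (IH (opposite x i) _ (inN i)) _.
  rewrite weight_incr pot_open// natrM /W le_eqVlt; apply/orP; left; apply/eqP.
  ring.
rewrite -(ler_pM2r s_gt0) mulr_suml; apply: le_trans (ler_sum _ op) _.
by rewrite -mulr_sumr -[leRHS]mulrA -expr2 ler_wpM2l// open_sum_le.
Qed.

End Walks.

(** * Trace moments of a random matrix as walk sums *)

Section TraceBound.
Variables (R : realFieldType) (n : nat) (I Omega : finType) (a b : I -> 'I_n).
Variables (mu : I -> nat -> R) (rho : Omega -> R) (xi : I -> Omega -> R).
Variable D : Omega -> 'M[R]_n.
Hypothesis D_entry : forall o x y,
  D o x y = \sum_(i | incident a b x i && (opposite a b x i == y)) xi i o.
Hypothesis moments : forall m : I -> nat,
  \sum_o rho o * \prod_i xi i o ^+ m i = \prod_i mu i (m i).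

(** An arbitrary history [m] makes the induction on [k] work: the first step of the walk multiplies
    by [xi i], which turns [m] into [incr m i]. *)
Lemma walk_sumE z k x (m : I -> nat) :
  \sum_o rho o * (\prod_i xi i o ^+ m i) * (D o ^+ k) x z = walk_sum a b mu z k x m.
Proof.
elim: k x m => [|k IH] x m /=.
  rewrite -moments mulr_sumr; apply: eq_bigr => o _.
  by rewrite expr0 -idmxE mxE mulrC.
under [RHS]eq_bigr => i _ do rewrite -IH.
rewrite exchange_big/=; apply: eq_bigr => o _.
have -> : (D o ^+ k.+1) x z =
    \sum_(i | incident a b x i) xi i o * (D o ^+ k) (opposite a b x i) z.
  rewrite exprS -mulmxE mxE (partition_big (opposite a b x) xpredT)//=.
  apply: eq_bigr => y _; rewrite D_entry mulr_suml.
  by apply: eq_bigr => i /andP[_ /eqP->].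
rewrite mulr_sumr; apply: eq_bigr => i _.
rewrite [in RHS](bigD1 i)//= [in LHS](bigD1 i)//= /incr eqxx addn1 exprSr.
rewrite [in RHS](eq_bigr (fun j => xi j o ^+ m j)); first by ring.
by move=> j /negPf->; rewrite addn0.
Qed.

Variables (w : I -> R) (s : R) (N : nat) (A B : R).
Hypothesis neq_ends : forall i, a i != b i.
Hypothesis mu_ge0 : forall i k, 0 <= mu i k.
Hypothesis mu0 : forall i, mu i 0%N = 1.
Hypothesis mu_odd : forall i k, odd k -> mu i k = 0.
Hypothesis mu_le : forall i k, (0 < k)%N -> mu i k <= w i.
Hypothesis w_ge0 : forall i, 0 <= w i.
Hypothesis w_row : forall x, \sum_(i | incident a b x i) w i <= A.
Hypothesis w_pair : forall x y,
  \sum_(i | incident a b x i && (opposite a b x i == y)) w i <= B.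
Hypothesis s_gt0 : 0 < s.
Hypothesis s2_ge : A + B * (2 * N)%:R + (N * N.+1)%:R <= s ^+ 2.

Lemma trace_moment_le : \sum_o rho o * \tr (D o ^+ N) <= n%:R * (2 * s) ^+ N.
Proof.
rewrite /mxtrace; under eq_bigr => o _ do rewrite mulr_sumr.
have -> : n%:R * (2 * s) ^+ N = \sum_(x < n) (2 * s) ^+ N.
  by rewrite sumr_const card_ord mulr_natl.
rewrite exchange_big/=; apply: ler_sum => x _.
(* With no label used yet, the weight, the potential and the power of [s] are all 1. *)
pose m0 (i : I) := 0%N.
have -> : \sum_o rho o * (D o ^+ N) x x = walk_sum a b mu x N x m0.
  rewrite -walk_sumE; apply: eq_bigr => o _.
  by rewrite big1 ?mulr1// => i _; rewrite expr0.
have := walk_sum_le neq_ends mu_ge0 mu0 mu_odd mu_le w_ge0 w_row w_pair s_gt0 s2_ge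
  x (k := N) x (m := m0).
rewrite /odd_count /weight pot_even// /m0 !big1// => /(_ (leqnn _)).
by rewrite expr0 mulr1 !mul1r.
Qed.

End TraceBound.

(** * Euclidean norm, operator norm and traces *)

Section Euclidean.
Variable R : realType.

Definition dot {n} (x y : 'cV[R]_n) : R := \sum_i x i ord0 * y i ord0.

Lemma dot_ge0 n (x : 'cV[R]_n) : 0 <= dot x x.
Proof. by apply: sumr_ge0 => i _; rewrite -expr2 sqr_ge0. Qed.

Lemma l2normE n (x : 'cV[R]_n) : l2norm x = Num.sqrt (dot x x).
Proof. by rewrite /l2norm; congr Num.sqrt; apply: eq_bigr => i _; rewrite expr2. Qed.

Lemma l2norm_ge0 n (x : 'cV[R]_n) : 0 <= l2norm x.
Proof. exact: sqrtr_ge0. Qed.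

Lemma sqr_l2norm n (x : 'cV[R]_n) : l2norm x ^+ 2 = dot x x.
Proof. by rewrite l2normE sqr_sqrtr// dot_ge0. Qed.

(** Cauchy-Schwarz: the sum of the squares (U v_i - P u_i)^2 equals U (UW - P^2). If U = 0 all [u i]
    vanish. *)
Lemma sqr_sum_mul_le (I : finType) (u v : I -> R) :
  (\sum_i u i * v i) ^+ 2 <= (\sum_i u i ^+ 2) * (\sum_i v i ^+ 2).
Proof.
set P := \sum_i u i * v i; set U := \sum_i u i ^+ 2; set W := \sum_i v i ^+ 2.
have U_ge0 : 0 <= U by apply: sumr_ge0 => i _; exact: sqr_ge0.
have : 0 <= \sum_i (U * v i - P * u i) ^+ 2 by apply: sumr_ge0 => i _; exact: sqr_ge0.
have -> : \sum_i (U * v i - P * u i) ^+ 2 = U * (U * W - P ^+ 2).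
  transitivity (\sum_i (U ^+ 2 * v i ^+ 2 - 2 * U * P * (u i * v i) + P ^+ 2 * u i ^+ 2)).
    by apply: eq_bigr => i _; ring.
  rewrite big_split/= sumrB -!mulr_sumr -/P -/U -/W; ring.
have [U0 _|U_neq0] := eqVneq U 0; last by rewrite pmulr_rge0 ?subr_ge0// lt0r U_neq0.
have u0 i : u i = 0.
  have : \sum_i u i ^+ 2 == 0 by rewrite -/U U0.
  rewrite psumr_eq0 => [/allP/(_ i)|j _]; last exact: sqr_ge0.
  by rewrite mem_index_enum => /(_ isT)/=; rewrite sqrf_eq0 => /eqP.
by rewrite U0 mul0r /P big1 ?expr0n// => i _; rewrite u0 mul0r.
Qed.

Lemma sqr_dot_le n (x y : 'cV[R]_n) : dot x y ^+ 2 <= dot x x * dot y y.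
Proof.
have := @sqr_sum_mul_le 'I_n (fun i => x i ord0) (fun i => y i ord0).
by rewrite /dot; under [in leRHS]eq_bigr do rewrite expr2;
   under [X in _ <= _ * X]eq_bigr do rewrite expr2.
Qed.

Lemma l2normD n (x y : 'cV[R]_n) : l2norm (x + y) <= l2norm x + l2norm y.
Proof.
rewrite -ler_sqr ?nnegrE ?addr_ge0 ?l2norm_ge0// sqrrD !sqr_l2norm.
have -> : dot (x + y) (x + y) = dot x x + dot x y *+ 2 + dot y y.
  rewrite /dot -sumrMnl -!big_split/=; apply: eq_bigr => i _; rewrite !mxE; ring.
rewrite lerD2r lerD2l lerMn2r/=; apply: le_trans (ler_norm _) _.
rewrite -ler_sqr ?nnegrE ?mulr_ge0 ?l2norm_ge0// exprMn !sqr_l2norm real_normK ?num_real//.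
exact: sqr_dot_le.
Qed.

Lemma l2normZ n (c : R) (x : 'cV[R]_n) : l2norm (c *: x) = `|c| * l2norm x.
Proof.
rewrite !l2normE; have -> : dot (c *: x) (c *: x) = c ^+ 2 * dot x x.
  by rewrite /dot mulr_sumr; apply: eq_bigr => i _; rewrite !mxE; ring.
by rewrite sqrtrM ?sqr_ge0// sqrtr_sqr.
Qed.

Lemma l2norm0 n : l2norm (0 : 'cV[R]_n) = 0.
Proof. by rewrite -(scale0r 0) l2normZ normr0 mul0r. Qed.

Lemma opnorm_ub m n (M : 'M[R]_(m, n)) x : l2norm x <= 1 -> l2norm (M *m x) <= opnorm M.
Proof. by move=> x1; apply: (ub_le_sup (opnorm_has_sup M).2); exists x. Qed.

Lemma opnorm_le m n (M : 'M[R]_(m, n)) c :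
  (forall x, l2norm x <= 1 -> l2norm (M *m x) <= c) -> opnorm M <= c.
Proof.
move=> Mc; apply: ge_sup; first exact: (opnorm_has_sup M).1.
by move=> _ [x /= x1 <-]; exact: Mc.
Qed.

Lemma opnorm_ge0 m n (M : 'M[R]_(m, n)) : 0 <= opnorm M.
Proof.
have := @opnorm_ub _ _ M 0; rewrite l2norm0 => /(_ ler01).
by apply: le_trans; exact: l2norm_ge0.
Qed.

Lemma opnormD m n (M N : 'M[R]_(m, n)) : opnorm (M + N) <= opnorm M + opnorm N.
Proof.
apply: opnorm_le => x x1; rewrite mulmxDl; apply: (le_trans (l2normD _ _)).
by rewrite lerD// opnorm_ub.
Qed.

Lemma opnormZ_le m n c (M : 'M[R]_(m, n)) : opnorm (c *: M) <= `|c| * opnorm M.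
Proof.
by apply: opnorm_le => x x1; rewrite -scalemxAl l2normZ ler_wpM2l// opnorm_ub.
Qed.

Lemma opnormZ m n c (M : 'M[R]_(m, n)) : opnorm (c *: M) = `|c| * opnorm M.
Proof.
apply/eqP; rewrite eq_le opnormZ_le/=.
have [->|c0] := eqVneq c 0; first by rewrite normr0 mul0r opnorm_ge0.
rewrite mulrC -ler_pdivlMr ?normr_gt0// mulrC -normfV.
by rewrite -[X in opnorm X <= _]scale1r -(mulVf c0) -scalerA opnormZ_le.
Qed.

Lemma opnorm0 m n : opnorm (0 : 'M[R]_(m, n)) = 0.
Proof. by rewrite -(scale0r 0) opnormZ normr0 mul0r. Qed.

Lemma opnorm_sum m n (J : finType) (F : J -> 'M[R]_(m, n)) :
  opnorm (\sum_j F j) <= \sum_j opnorm (F j).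
Proof.
elim/big_ind2: _ => [|x M y N hx hy|//]; first by rewrite opnorm0.
by apply: (le_trans (opnormD _ _)); exact: lerD.
Qed.

Lemma pow_ratio_le (u : nat -> R) p : (forall j, 0 <= u j) -> u 0%N <= 1 ->
  (forall j, u j.+1 ^+ 2 <= u j * u j.+2) -> u 1%N ^+ p.+1 <= u p.+1.
Proof.
move=> u_ge0 u0 ulc.
(* The ratios u j.+1 / u j are nondecreasing. *)
have step j : u 1%N * u j <= u j.+1.
  elim: j => [|j IH]; first by rewrite ler_piMr.
  have [->|uj] := eqVneq (u j.+1) 0; first by rewrite mulr0.
  have uj_gt0 : 0 < u j.+1 by rewrite lt0r uj u_ge0.
  rewrite -(ler_pM2r uj_gt0) -mulrA -expr2.
  apply: (le_trans (ler_wpM2l (u_ge0 _) (ulc j))).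
  by rewrite mulrA [leRHS]mulrC ler_wpM2r.
elim: p => [|p IH]; first by rewrite expr1.
by rewrite exprS; apply: le_trans (step _); rewrite ler_wpM2l.
Qed.

Lemma dot_sym n (D : 'M[R]_n) x y : D^T = D -> dot (D *m x) y = dot x (D *m y).
Proof.
move=> DT; rewrite /dot.
transitivity (\sum_i \sum_j D i j * x j ord0 * y i ord0).
  by apply: eq_bigr => i _; rewrite mxE mulr_suml.
rewrite exchange_big/=; apply: eq_bigr => j _; rewrite mxE mulr_sumr.
by apply: eq_bigr => i _; rewrite -[in RHS]DT mxE; ring.
Qed.

Lemma trmxX n (D : 'M[R]_n) k : D^T = D -> (D ^+ k)^T = D ^+ k.
Proof.
move=> DT; elim: k => [|k IH]; first by rewrite expr0 -idmxE trmx1.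
by rewrite {1}exprS -mulmxE trmx_mul IH DT mulmxE -exprSr.
Qed.

(** The sequence |D^j x|^2 is log-convex by symmetry and Cauchy-Schwarz, so |D x|^(2(p+1)) is at
    most |D^(p+1) x|^2 for |x| <= 1, and the squared Frobenius norm of D^(p+1) is the trace. *)
Lemma opnorm_pow_le_tr n (D : 'M[R]_n) p : D^T = D ->
  opnorm D ^+ (2 * p.+1) <= \tr (D ^+ (2 * p.+1)).
Proof.
move=> DT; have tr_ge0 : 0 <= \tr (D ^+ (2 * p.+1)).
  rewrite mul2n -addnn exprD -mulmxE; apply: sumr_ge0 => i _; rewrite mxE.
  by apply: sumr_ge0 => j _; rewrite -{2}(trmxX p.+1 DT) mxE -expr2 sqr_ge0.
set t := \tr _ in tr_ge0 *; set k := (2 * p.+1)%N.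
have k_neq0 : k%:R != 0 :> R by rewrite pnatr_eq0.
(* A supremum is bounded through its elements, so [opnorm D] is compared with the k-th root of [t]
   and the power is taken back vector by vector. *)
have rootK : (t `^ k%:R^-1) ^+ k = t.
  by rewrite -powR_mulrn ?powR_ge0// -powRrM mulVf// powRr1.
suff le1 : opnorm D <= t `^ k%:R^-1.
  by rewrite -rootK lerXn2r ?nnegrE ?opnorm_ge0 ?powR_ge0.
apply: opnorm_le => x x1.
rewrite -(@ler_pXn2r _ k)// ?nnegrE ?l2norm_ge0 ?powR_ge0//.
rewrite rootK /k exprM.
have x1' : dot x x <= 1 by rewrite -sqr_l2norm expr_le1 ?l2norm_ge0.
pose u j := dot (D ^+ j *m x) (D ^+ j *m x).
have uS j : D ^+ j.+1 *m x = D *m (D ^+ j *m x) by rewrite mulmxA mulmxE -exprS.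
apply: (@le_trans _ _ (u p.+1)).
  rewrite sqr_l2norm.
  have -> : dot (D *m x) (D *m x) = u 1%N by rewrite /u expr1.
  apply: pow_ratio_le => [j|| j]; first exact: dot_ge0.
    by rewrite /u expr0 -idmxE mul1mx.
  by rewrite /u {1 2}uS dot_sym// -uS -uS; exact: sqr_dot_le.
(* t is the squared Frobenius norm of D ^+ p.+1. *)
apply: (@le_trans _ _ (t * dot x x)); last by rewrite ler_piMr.
have -> : t = \sum_i \sum_j (D ^+ p.+1) i j ^+ 2.
  rewrite /t mul2n -addnn exprD -mulmxE; apply: eq_bigr => i _; rewrite mxE.
  by apply: eq_bigr => j _; rewrite -{2}(trmxX p.+1 DT) mxE -expr2.
rewrite mulr_suml /u /dot; apply: ler_sum => i _; rewrite -expr2 mxE.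
have := sqr_sum_mul_le (fun j => (D ^+ p.+1) i j) (fun j => x j ord0).
by under [X in _ <= _ * X -> _]eq_bigr do rewrite expr2.
Qed.

End Euclidean.

(** * Edges of the complete graph and the law of the observations *)

Section Edges.
Variable n : nat.

Definition fst_end (e : edge n) : 'I_n := (val e).1.
Definition snd_end (e : edge n) : 'I_n := (val e).2.

Lemma neq_edge_ends (e : edge n) : fst_end e != snd_end e.
Proof. by rewrite -val_eqE neq_ltn (valP e). Qed.

(** Edges are stored with increasing ends, so exactly one joins two distinct vertices, in an
    orientation left open here. *)
Lemma edge_join x y : x != y -> exists e0 : edge n,
  (val e0 = (x, y) \/ val e0 = (y, x)) /\
  forall e, incident fst_end snd_end x e && (opposite fst_end snd_end x e == y) = (e == e0).
Proof.
have ordE (s t : 'I_n) : (s == t) = (nat_of_ord s == nat_of_ord t) by [].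
rewrite ordE neq_ltn => /orP[xy|yx];
  [exists (exist _ (x, y) xy)|exists (exist _ (y, x) yx)];
  (split; first by [left|right]) => -[[u v] /= uv];
  rewrite -[_ == exist _ _ _]val_eqE /incident /opposite /fst_end /snd_end /=;
  rewrite xpair_eqE !ordE (fun_if (@nat_of_ord n));
  case: (nat_of_ord x =P nat_of_ord u) => ?; lia.
Qed.

Lemma sym_of_edges_diag (f : edge n -> bool) x : sym_of_edges f x x = false.
Proof. by rewrite mxE insubF //= ltnn. Qed.

Lemma sym_of_edgesE (f : edge n -> bool) x y (e0 : edge n) :
  val e0 = (x, y) \/ val e0 = (y, x) -> sym_of_edges f x y = f e0.
Proof.
have insubE (e : edge n) : insub (val e) = Some e by rewrite valK.
have insubF' (e : edge n) : insub ((val e).2, (val e).1) = None :> option (edge n).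
  by rewrite insubF //= ltnNge ltnW ?(valP e).
by rewrite mxE => -[] e0E; move: (insubE e0) (insubF' e0); rewrite e0E /= => -> -> /=;
  rewrite ?orbF.
Qed.

End Edges.

Section EdgeLaw.
Variables (R : realType) (n : nat).

Definition edge_prob (Theta P : 'M[R]_n) (e : edge n) : R :=
  P (fst_end e) (snd_end e) * Theta (fst_end e) (snd_end e).

(** Thinning: the product of two independent coins is a coin whose success probability is the
    product, and pairing the coins edge by edge keeps the edges independent. *)
Lemma coin_edge_law (Theta P : 'M[R]_n) (u : {ffun edge n -> bool}) :
  \sum_(w : {ffun edge n + edge n -> bool} | [forall e, (w (inr e) && w (inl e)) == u e])
     bernoulli_prod_pmf (coin_prob Theta P) w
  = bernoulli_prod_pmf (edge_prob Theta P) u.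
Proof.
pose join (v : {ffun edge n -> bool * bool}) : {ffun edge n + edge n -> bool} :=
  [ffun k => match k with inl e => (v e).1 | inr e => (v e).2 end].
pose split (w : {ffun edge n + edge n -> bool}) : {ffun edge n -> bool * bool} :=
  [ffun e => (w (inl e), w (inr e))].
rewrite (reindex_onto join split) /=; last first.
  by move=> w _; apply/ffunP => -[] e; rewrite !ffunE.
transitivity (\prod_e \sum_(b : bool * bool | (b.2 && b.1) == u e)
   (bernoulli_pmf (coin_prob Theta P (inl e)) b.1 *
    bernoulli_pmf (coin_prob Theta P (inr e)) b.2)).
  rewrite bigA_distr_big_dep; apply: eq_big => [v|v _].
    have -> : split (join v) == v.
      by apply/eqP/ffunP => e; rewrite !ffunE -surjective_pairing.
    rewrite andbT; apply/forallP/familyP => H e; move: (H e).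
      by rewrite !ffunE.
    by rewrite !ffunE.
  rewrite /bernoulli_prod_pmf big_sumType big_split/=.
  by congr (_ * _); apply: eq_bigr => e _; rewrite !ffunE.
apply: eq_bigr => e _; rewrite /edge_prob /fst_end /snd_end big_mkcond.
rewrite -(pair_bigA _ (fun b1 b2 => if (b2 && b1) == u e then
   bernoulli_pmf (coin_prob Theta P (inl e)) b1 *
   bernoulli_pmf (coin_prob Theta P (inr e)) b2 else 0))/=.
by rewrite !big_bool/=; case: (u e) => /=; ring.
Qed.

Lemma irgml_pmf_edges (Theta P : 'M[R]_n) (y : 'M[bool]_n) :
  irgml_pmf Theta P y =
  \sum_(u : {ffun edge n -> bool} | sym_of_edges u == y)
     bernoulli_prod_pmf (edge_prob Theta P) u.
Proof.
pose g (w : {ffun edge n + edge n -> bool}) := [ffun e => w (inr e) && w (inl e)].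
have gE w : observed_mx w = sym_of_edges (g w).
  by congr sym_of_edges; apply/funext => e; rewrite ffunE.
rewrite /irgml_pmf (partition_big g (fun u => sym_of_edges u == y))/=; last first.
  by move=> w; rewrite gE.
apply: eq_bigr => u uy; rewrite -coin_edge_law; apply: eq_bigl => w.
apply/andP/forallP => [[_ /eqP<-] e|H]; first by rewrite ffunE.
have gu : g w = u by apply/ffunP => e; rewrite ffunE; exact/eqP.
by rewrite gE gu uy.
Qed.

Definition obs_of_edges T (u : {ffun 'I_T * edge n -> bool}) : obs n T :=
  [ffun t => sym_of_edges (fun e => u (t, e))].

(** Reduces the whole sample to one family of independent coins indexed by (time, edge), the labels
    of the multigraph. *)
Lemma obs_prob_edges T (Theta : 'I_T -> 'M[R]_n) P (E : pred (obs n T)) :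
  obs_prob Theta P E =
  \sum_(u | E (obs_of_edges u))
     bernoulli_prod_pmf (fun i : 'I_T * edge n => edge_prob (Theta i.1) P i.2) u.
Proof.
rewrite /obs_prob; under eq_bigr => Y _ do
  under eq_bigr => t _ do rewrite irgml_pmf_edges.
under eq_bigr => Y _ do rewrite bigA_distr_big_dep.
pose o (U : {ffun 'I_T -> {ffun edge n -> bool}}) : obs n T := [ffun t => sym_of_edges (U t)].
transitivity (\sum_(U : {ffun 'I_T -> {ffun edge n -> bool}} | E (o U))
    \prod_t bernoulli_prod_pmf (edge_prob (Theta t) P) (U t)).
  rewrite [RHS](partition_big o E)//=; apply: eq_bigr => Y EY; apply: eq_bigl => U.
  apply/familyP/andP => [H|[_ /eqP<-] t]; last by rewrite -topredE /= ffunE.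
  have oU : o U = Y by apply/ffunP => t; rewrite ffunE; exact/eqP/H.
  by rewrite oU.
pose flat (U : {ffun 'I_T -> {ffun edge n -> bool}}) : {ffun 'I_T * edge n -> bool} :=
  [ffun i => U i.1 i.2].
pose unflat (u : {ffun 'I_T * edge n -> bool}) : {ffun 'I_T -> {ffun edge n -> bool}} :=
  [ffun t => [ffun e => u (t, e)]].
rewrite (reindex_onto unflat flat) /=; last first.
  by move=> U _; apply/ffunP => t; apply/ffunP => e; rewrite !ffunE.
apply: eq_big => [u|u _].
  have -> : flat (unflat u) == u.
    by apply/eqP/ffunP => -[t e]; rewrite !ffunE.
  rewrite andbT; congr E; apply/ffunP => t; rewrite !ffunE.
  by congr sym_of_edges; apply/funext => e; rewrite ffunE.
rewrite /bernoulli_prod_pmf pair_bigA/=.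
by apply: eq_bigr => -[t e] _; rewrite !ffunE.
Qed.

End EdgeLaw.

(** * Jensen's inequality for powers *)

Section PowerMean.
Variable R : realFieldType.

(** Convexity: the power lies above its tangent at [y]. Averaging this at the mean gives Jensen's
    inequality. *)
Lemma pow_tangent_le (x y : R) k : 0 <= x -> 0 <= y ->
  y ^+ k.+1 + k.+1%:R * y ^+ k * (x - y) <= x ^+ k.+1.
Proof.
move=> x0 y0; elim: k => [|k IH]; first by rewrite !expr1 expr0; lra.
rewrite [leRHS]exprS; apply: le_trans (ler_wpM2l x0 IH).
rewrite -subr_ge0.
have -> : x * (y ^+ k.+1 + k.+1%:R * y ^+ k * (x - y)) -
   (y ^+ k.+2 + k.+2%:R * y ^+ k.+1 * (x - y)) = k.+1%:R * y ^+ k * (x - y) ^+ 2.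
  by rewrite !exprS -[k.+2%:R]natr1; ring.
by rewrite mulr_ge0 ?sqr_ge0// mulr_ge0 ?exprn_ge0.
Qed.

Lemma pow_mean_le (J : finType) (q f : J -> R) k : (forall j, 0 <= q j) ->
  (forall j, 0 <= f j) -> \sum_j q j = 1 ->
  (\sum_j q j * f j) ^+ k.+1 <= \sum_j q j * f j ^+ k.+1.
Proof.
move=> q0 f0 q1; set y := \sum_j q j * f j.
have y0 : 0 <= y by apply: sumr_ge0 => j _; rewrite mulr_ge0.
have -> : y ^+ k.+1 = \sum_j q j * (y ^+ k.+1 + k.+1%:R * y ^+ k * (f j - y)).
  transitivity (\sum_j (q j * (y ^+ k.+1 - k.+1%:R * y ^+ k * y)
                        + k.+1%:R * y ^+ k * (q j * f j))).
    rewrite big_split/= -mulr_suml q1 -mulr_sumr -/y; ring.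
  by apply: eq_bigr => j _; ring.
by apply: ler_sum => j _; rewrite ler_wpM2l// pow_tangent_le.
Qed.

End PowerMean.

(** * Moments and tails of a centered weighted sum of Bernoulli adjacency matrices *)

Section BernoulliMatrix.
Variables (R : realType) (n T : nat).
Let I : finType := ('I_T * edge n)%type.
Variables (p : I -> R) (c : 'I_T -> R) (omega : R).

Definition label_fst (i : I) : 'I_n := fst_end i.2.
Definition label_snd (i : I) : 'I_n := snd_end i.2.

(** Parallel edges between two vertices are indexed by time, so an off-diagonal entry is a sum over
    time weighted by [c]. *)
Definition bernoulli_mx (u : {ffun I -> bool}) : 'M[R]_n :=
  \matrix_(x, y) \sum_(i | incident label_fst label_snd x i &&
                          (opposite label_fst label_snd x i == y)) c i.1 * (u i)%:R.

Definition bernoulli_mx_mean : 'M[R]_n :=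
  \sum_u bernoulli_prod_pmf p u *: bernoulli_mx u.

Hypothesis p01 : forall i, 0 <= p i <= 1.
Hypothesis c_le1 : forall t, c t ^+ 2 <= 1.
Hypothesis c_sum : \sum_t c t ^+ 2 = 1.
Hypothesis omega_gt0 : 0 < omega.
Hypothesis row_le : forall x,
  \sum_(i | incident label_fst label_snd x i) c i.1 ^+ 2 * p i <= omega.

Lemma label_neq i : label_fst i != label_snd i.
Proof. exact: neq_edge_ends. Qed.

(** Moments of the symmetrized entry c (b - b'). Exchanging b and b' kills the odd ones; the even
    ones are 2 p (1 - p) c^k, at most [w i] because c^2 <= 1. *)
Let mu (i : I) (k : nat) : R :=
  \sum_b \sum_b' bernoulli_pmf (p i) b * bernoulli_pmf (p i) b' *
     (c i.1 * (b%:R - b'%:R)) ^+ k.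

Let muE i k : (0 < k)%N ->
  mu i k = p i * (1 - p i) * (c i.1 ^+ k + (- c i.1) ^+ k).
Proof.
move=> k0; rewrite /mu !big_bool/= !subrr !mulr0 !expr0n !subr0 sub0r mulr1 mulrN1.
by rewrite eqn0Ngt k0 /=; ring.
Qed.

Let mu0 i : mu i 0 = 1.
Proof. by rewrite /mu !big_bool/= !expr0; ring. Qed.

Let mu_odd i k : odd k -> mu i k = 0.
Proof.
move=> ok; rewrite muE ?odd_gt0// exprNn -signr_odd ok expr1 mulN1r subrr mulr0 //.
Qed.

Let pq_ge0 i : 0 <= p i * (1 - p i).
Proof. by have /andP[p0 p1] := p01 i; rewrite mulr_ge0// subr_ge0. Qed.

Let mu_ge0 i k : 0 <= mu i k.
Proof.
have [/mu_odd->//|ek] := boolP (odd k).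
case: k ek => [|k] ek; first by rewrite mu0.
rewrite muE// mulr_ge0// addr_ge0// exprn_even_ge0//.
Qed.

Let w (i : I) : R := 2 * (c i.1 ^+ 2 * p i).

Let w_ge0 i : 0 <= w i.
Proof. by rewrite mulr_ge0// mulr_ge0 ?sqr_ge0//; have /andP[] := p01 i. Qed.

Let mu_le i k : (0 < k)%N -> mu i k <= w i.
Proof.
have [/mu_odd-> //|ek k0] := boolP (odd k).
have [j kE] : exists j, k = (j.+1).*2.
  exists k./2.-1; have := odd_double_half k; rewrite (negPf ek) add0n.
  by case: (k./2) k0 => [|//]; rewrite double0 => + E; rewrite -E.
rewrite muE// kE -mul2n !exprM sqrrN.
have cj : (c i.1 ^+ 2) ^+ j.+1 <= c i.1 ^+ 2.
  by rewrite exprSr ler_piMl ?sqr_ge0// exprn_ile1 ?sqr_ge0.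
have /andP[p0 p1] := p01 i.
have ppq : p i * (1 - p i) <= p i by rewrite ler_piMr// lerBlDr lerDl.
set X := (c i.1 ^+ 2) ^+ j.+1 in cj *.
have -> : p i * (1 - p i) * (X + X) = 2 * (X * (p i * (1 - p i))) by ring.
rewrite /w ler_wpM2l//.
by rewrite ler_pM// exprn_ge0 ?sqr_ge0.
Qed.

Let sum_edges x (F : I -> R) (Q : pred I) :
  \sum_(i | incident label_fst label_snd x i && Q i) F i =
  \sum_t \sum_(e | incident (@fst_end n) (@snd_end n) x e && Q (t, e)) F (t, e).
Proof. by rewrite pair_big_dep; apply: eq_big => [] [t e]. Qed.

Lemma label_sum_join (x y : 'I_n) (F : I -> R) : x != y ->
  exists e0 : edge n, (val e0 = (x, y) \/ val e0 = (y, x)) /\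
  \sum_(i | incident label_fst label_snd x i && (opposite label_fst label_snd x i == y)) F i
  = \sum_t F (t, e0).
Proof.
move=> /edge_join [e0 [e0E H]]; exists e0; split=> //.
rewrite sum_edges; apply: eq_bigr => t _.
by rewrite (eq_bigl (pred1 e0)) ?big_pred1_eq.
Qed.

Lemma label_sum_diag (x : 'I_n) (F : I -> R) :
  \sum_(i | incident label_fst label_snd x i && (opposite label_fst label_snd x i == x)) F i = 0.
Proof.
by rewrite big_pred0// => i; apply/andP => -[/(opposite_neq label_neq)/negPf->].
Qed.

(** Two distinct vertices share one edge per time, and the squared coefficients sum to 1. *)
Let w_pair x y :
  \sum_(i | incident label_fst label_snd x i && (opposite label_fst label_snd x i == y)) w i <= 2.
Proof.
have [->|xy] := eqVneq x y; first by rewrite label_sum_diag.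
have [e0 [_ ->]] := label_sum_join w xy.
have -> : 2 = \sum_t 2 * c t ^+ 2 :> R by rewrite -mulr_sumr c_sum mulr1.
apply: ler_sum => t _.
rewrite /w ler_wpM2l//= ler_piMr ?sqr_ge0//.
by have /andP[] := p01 (t, e0).
Qed.

Let Omega : finType := ({ffun I -> bool} * {ffun I -> bool})%type.
Let rho (o : Omega) : R := bernoulli_prod_pmf p o.1 * bernoulli_prod_pmf p o.2.
Let xi (i : I) (o : Omega) : R := c i.1 * ((o.1 i)%:R - (o.2 i)%:R).

Let moments (m : I -> nat) :
  \sum_o rho o * \prod_i xi i o ^+ m i = \prod_i mu i (m i).
Proof.
rewrite bigA_distr_bigA -(pair_bigA _ (fun u u' => rho (u, u') * \prod_i xi i (u, u') ^+ m i))/=.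
apply: eq_bigr => u _; rewrite bigA_distr_bigA; apply: eq_bigr => u' _.
by rewrite /rho /xi /bernoulli_prod_pmf !big_split/=.
Qed.

Lemma bernoulli_mx_sym u : (bernoulli_mx u)^T = bernoulli_mx u.
Proof.
apply/matrixP => x y; rewrite !mxE; apply: eq_bigl => i.
by rewrite (opposite_sym label_neq).
Qed.

Let bpp_ge0 u : 0 <= bernoulli_prod_pmf p u.
Proof. by apply: prodr_ge0 => i _; apply: bernoulli_pmf_ge0. Qed.

Lemma opnorm_centered_moment_le q (N := (2 * q.+1)%N) :
  \sum_u bernoulli_prod_pmf p u * opnorm (bernoulli_mx u - bernoulli_mx_mean) ^+ N
  <= n%:R * (4 * (2 * omega + (4 * N + N * N.+1)%:R)) ^+ q.+1.
Proof.
set S := bernoulli_mx; set P := bernoulli_prod_pmf p.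
have P1 : \sum_u P u = 1 by exact: bernoulli_prod_pmf_sum1.
apply: (@le_trans _ _ (\sum_u P u * \sum_u' P u' * opnorm (S u - S u') ^+ N)).
  apply: ler_sum => u _; rewrite ler_wpM2l//.
  (* The mean is the average of an independent copy, so Jensen's inequality can move that average
     outside the power. *)
  have -> : S u - bernoulli_mx_mean = \sum_u' P u' *: (S u - S u').
    rewrite (eq_bigr (fun u' => P u' *: S u - P u' *: S u')); last first.
      by move=> u' _; rewrite scalerBr.
    by rewrite sumrB -scaler_suml P1 scale1r.
  have NE : N = (2 * q).+1.+1 by rewrite /N mulnS.
  rewrite NE; apply: le_trans (pow_mean_le _ bpp_ge0 (fun=> opnorm_ge0 _) P1).
  rewrite lerXn2r ?nnegrE ?opnorm_ge0//.
    by apply: sumr_ge0 => u' _; rewrite mulr_ge0 ?opnorm_ge0.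
  apply: le_trans (opnorm_sum _) _; apply: ler_sum => u' _.
  by rewrite opnormZ ger0_norm.
pose D (o : Omega) := S o.1 - S o.2.
apply: (@le_trans _ _ (\sum_o rho o * \tr (D o ^+ N))).
  rewrite -(pair_bigA _ (fun u u' => rho (u, u') * \tr (D (u, u') ^+ N)))/=.
  apply: ler_sum => u _; rewrite mulr_sumr; apply: ler_sum => u' _.
  rewrite mulrA ler_wpM2l ?mulr_ge0//; apply: opnorm_pow_le_tr.
  by rewrite /D/= linearB/= !bernoulli_mx_sym.
set L := 2 * omega + _.
have L_gt0 : 0 < L by rewrite ltr_wpDr// mulr_gt0.
(* The trace bound is used with s = sqrt L, A = 2 omega and B = 2; the summand 4N in [L] is B times
   2N. *)
have -> : (4 * L) ^+ q.+1 = (2 * Num.sqrt L) ^+ N.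
  by rewrite /N [RHS]exprM; congr (_ ^+ _); rewrite exprMn (sqr_sqrtr (ltW L_gt0)) -natrX.
apply: (trace_moment_le (D := D) _ moments label_neq mu_ge0 mu0 mu_odd mu_le w_ge0
  _ w_pair (A := 2 * omega)).
- move=> o x y; rewrite /D !mxE -sumrB; apply: eq_bigr => i _.
  by rewrite /xi mulrBr.
- by move=> x; rewrite -mulr_sumr ler_wpM2l.
- by rewrite sqrtr_gt0.
by rewrite (sqr_sqrtr (ltW L_gt0)) /L -[leLHS]addrA lerD2l -natrM -natrD ler_nat mulnA.
Qed.

(** Markov's inequality, multiplied out since [H] may be 0. *)
Lemma opnorm_tail_le q H (N := (2 * q.+1)%N) : 0 <= H ->
  (\sum_(u | H <= opnorm (bernoulli_mx u - bernoulli_mx_mean)) bernoulli_prod_pmf p u)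
    * H ^+ N
  <= n%:R * (4 * (2 * omega + (4 * N + N * N.+1)%:R)) ^+ q.+1.
Proof.
move=> H0; apply: le_trans (opnorm_centered_moment_le q).
rewrite mulr_suml [leRHS](bigID (fun u => H <= opnorm (bernoulli_mx u - bernoulli_mx_mean)))/=.
rewrite -[leLHS]addr0 lerD//; last first.
  by apply: sumr_ge0 => u _; rewrite mulr_ge0 ?exprn_ge0 ?opnorm_ge0.
by apply: ler_sum => u Hu; rewrite ler_wpM2l// lerXn2r ?nnegrE ?opnorm_ge0.
Qed.

End BernoulliMatrix.

(** * The CUSUM statistic as a weighted Bernoulli matrix *)

Lemma sum_ord_step (R : pzRingType) (T tau : nat) (A B : R) : (tau <= T)%N ->
  \sum_(t < T) (if (t < tau)%N then A else B) = A * tau%:R + B * (T - tau)%:R.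
Proof.
move=> /subnKC <-; rewrite !mulr_natr big_split_ord/= addKn; congr (_ + _).
  by under eq_bigr => i _ do rewrite ltn_ord; rewrite sumr_const card_ord.
under eq_bigr => i _ do rewrite ltnNge leq_addr/=.
by rewrite sumr_const card_ord.
Qed.

(** The mean of an indicator is a probability, so the product formula applies with a single
    constrained coordinate. *)
Lemma bernoulli_prod_mean (R : realType) (I : finType) (p : I -> R) i :
  \sum_u bernoulli_prod_pmf p u * (u i)%:R = p i.
Proof.
transitivity (\sum_(u : {ffun I -> bool} | [forall j, (j == i) ==> u j]) bernoulli_prod_pmf p u).
  rewrite [RHS]big_mkcond; apply: eq_bigr => u _.
  have -> : [forall j, (j == i) ==> u j] = u i.
    by apply/forallP/idP => [/(_ i)|ui j]; rewrite ?eqxx//; apply/implyP => /eqP->.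
  by case: (u i); rewrite ?mulr1 ?mulr0.
rewrite (bernoulli_prod_pmf_indep p (fun j b => (j == i) ==> b)) (bigD1 i)//= eqxx.
rewrite big_mkcond big_bool/= addr0 big1 ?mulr1// => j /negPf->.
by rewrite big_bool/= addrC subrK.
Qed.

Section Cusum.
Variables (R : realType) (n T tau : nat).
Hypothesis tau_gt0 : (0 < tau)%N.
Hypothesis tau_lt : (tau < T)%N.

Definition cusum_scale : R := Num.sqrt (tau%:R * (T - tau)%:R / T%:R).

(** A unit vector orthogonal to the constants: unit length keeps the row weights below omega,
    orthogonality makes the mean vanish without a change. *)
Definition cusum_coef (t : 'I_T) : R :=
  if (t < tau)%N then cusum_scale / tau%:R else - (cusum_scale / (T - tau)%:R).

Let tau_neq0 : tau%:R != 0 :> R.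
Proof. by rewrite pnatr_eq0 -lt0n. Qed.

Let sub_neq0 : (T - tau)%:R != 0 :> R.
Proof. by rewrite pnatr_eq0 -lt0n subn_gt0. Qed.

Let T_neq0 : T%:R != 0 :> R.
Proof. by rewrite pnatr_eq0 -lt0n (leq_trans _ tau_lt). Qed.

Let T_split : T%:R = tau%:R + (T - tau)%:R :> R.
Proof. by rewrite -natrD subnKC// ltnW. Qed.

(** Converts the scale of the statistic into the factor [qfun] that measures separation. *)
Lemma cusum_scaleE : cusum_scale = Num.sqrt T%:R * qfun (tau%:R / T%:R).
Proof.
rewrite /qfun -sqrtrM ?ler0n//; congr Num.sqrt.
have := T_neq0; rewrite T_split; move: (tau%:R) ((T - tau)%:R) => x y xy; field.
by [].
Qed.

Lemma sum_cusum_coef : \sum_t cusum_coef t = 0.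
Proof.
rewrite sum_ord_step 1?ltnW// mulNr !divfK// subrr //.
Qed.

Lemma sum_sqr_cusum_coef : \sum_t cusum_coef t ^+ 2 = 1.
Proof.
rewrite (eq_bigr (fun t : 'I_T => if (t < tau)%N then (cusum_scale / tau%:R) ^+ 2
    else (cusum_scale / (T - tau)%:R) ^+ 2)); last first.
  by move=> t _; rewrite /cusum_coef; case: ifP => _ //; rewrite sqrrN.
rewrite sum_ord_step 1?ltnW// !exprMn sqr_sqrtr ?divr_ge0 ?mulr_ge0//.
have := T_neq0; have := tau_neq0; have := sub_neq0; rewrite T_split.
move: (tau%:R) ((T - tau)%:R) => x y x0 y0 xy; field.
by rewrite xy x0 y0.
Qed.

Lemma sqr_cusum_coef_le1 t : cusum_coef t ^+ 2 <= 1.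
Proof.
by rewrite -sum_sqr_cusum_coef (bigD1 t)//= lerDl sumr_ge0// => s _; exact: sqr_ge0.
Qed.

Lemma cusum_obs_of_edges (u : {ffun 'I_T * edge n -> bool}) :
  cusum (obs_of_edges u) tau = bernoulli_mx cusum_coef u.
Proof.
apply/matrixP => x y; rewrite !mxE !summxE.
have [->|xy] := eqVneq x y.
  rewrite label_sum_diag !big1 ?mulr0 ?subrr ?mulr0// => t _;
  by rewrite mxE ffunE sym_of_edges_diag.
have [e0 [e0E ->]] := label_sum_join (fun i => cusum_coef i.1 * (u i)%:R) xy.
rewrite [RHS](bigID (fun t : 'I_T => (t < tau)%N))/= mulrBr !mulrA -/cusum_scale.
rewrite !mulr_sumr -sumrN; congr (_ + _).
  by apply: eq_bigr => t lt; rewrite mxE ffunE (sym_of_edgesE _ e0E) /cusum_coef lt.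
apply: eq_big => t; first by rewrite -leqNgt.
rewrite leqNgt => /negPf lt.
by rewrite mxE ffunE (sym_of_edgesE _ e0E) /cusum_coef lt mulNr.
Qed.

Section Model.
Variables (Theta : 'I_T -> 'M[R]_n) (P : 'M[R]_n) (omega : R).
Hypothesis params : forall t, param_set omega (Theta t, P).

Let p (i : 'I_T * edge n) : R := edge_prob (Theta i.1) P i.2.

Definition cusum_mean : 'M[R]_n := \sum_t cusum_coef t *: hadamard P (Theta t).

Let edge_probE t x y (e : edge n) : val e = (x, y) \/ val e = (y, x) ->
  p (t, e) = hadamard P (Theta t) x y.
Proof.
have [[[/= symT _] _] [[/= symP _] _ _] _] := params t.
rewrite /p /edge_prob /fst_end /snd_end /= => -[] ->; first by rewrite mxE.
by rewrite [RHS]mxE /= -[in LHS]symT -[in LHS]symP !mxE.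
Qed.

Let hadamard_diag t x : hadamard P (Theta t) x x = 0.
Proof. by have [[_ diag0] _ _] := params t; rewrite mxE /= diag0 mulr0. Qed.

Lemma edge_prob_01 i : 0 <= p i <= 1.
Proof.
have [[[_ T01] _] [[_ P01] _ _] _] := params i.1.
have /andP[T0 T1] := T01 (fst_end i.2) (snd_end i.2).
have /andP[P0 P1] := P01 (fst_end i.2) (snd_end i.2).
by rewrite /p /edge_prob mulr_ge0//= mulr_ile1.
Qed.

Lemma bernoulli_mx_meanE : bernoulli_mx_mean p cusum_coef = cusum_mean.
Proof.
apply/matrixP => x y; rewrite /bernoulli_mx_mean /cusum_mean !summxE.
under eq_bigr => u _ do rewrite !mxE.
have [->|xy] := eqVneq x y.
  rewrite !big1// => [t _|u _]; first by rewrite mxE hadamard_diag mulr0.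
  by rewrite label_sum_diag mulr0.
under eq_bigr => u _ do rewrite mulr_sumr.
rewrite exchange_big/=.
under eq_bigr => i _ do
  (under eq_bigr => u _ do rewrite mulrCA; rewrite -mulr_sumr bernoulli_prod_mean).
have [e1 [e1E ->]] := label_sum_join (fun i => cusum_coef i.1 * p i) xy.
by apply: eq_bigr => t _; rewrite [RHS]mxE (edge_probE _ e1E).
Qed.

(** With weights [cusum_coef t ^+ 2], the left side is at most a convex combination over time of
    column sums, each bounded by omega. *)
Lemma cusum_row_le x :
  \sum_(i | incident (@label_fst n T) (@label_snd n T) x i) cusum_coef i.1 ^+ 2 * p i <= omega.
Proof.
rewrite (partition_big (opposite (@label_fst n T) (@label_snd n T) x) xpredT)//=.
(* The entry is read at (y, x), by symmetry, because [norm_1inf] sums down columns. *)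
apply: (@le_trans _ _ (\sum_y \sum_t cusum_coef t ^+ 2 * `|hadamard P (Theta t) y x|)).
  apply: ler_sum => y _; have [->|xy] := eqVneq x y.
    by rewrite label_sum_diag; apply: sumr_ge0 => t _; rewrite mulr_ge0 ?sqr_ge0.
  have [e0 [e0E ->]] := label_sum_join (fun i => cusum_coef i.1 ^+ 2 * p i) xy.
  apply: ler_sum => t _; rewrite ler_wpM2l ?sqr_ge0// (@edge_probE t y x); last exact/or_comm.
  exact: ler_norm.
rewrite exchange_big/= -[leRHS]mul1r -sum_sqr_cusum_coef mulr_suml.
apply: ler_sum => t _; rewrite -mulr_sumr ler_wpM2l ?sqr_ge0//.
have [_ _] := params t; apply: le_trans.
exact: (le_bigmax _ (fun j => \sum_i `|hadamard P (Theta t) i j|)).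
Qed.

Hypothesis omega_gt0 : 0 < omega.

Lemma cusum_tail_le q H (N := (2 * q.+1)%N) : 0 <= H ->
  obs_prob Theta P (fun Y => H <= opnorm (cusum Y tau - cusum_mean)) * H ^+ N
  <= n%:R * (4 * (2 * omega + (4 * N + N * N.+1)%:R)) ^+ q.+1.
Proof.
move=> H0; rewrite obs_prob_edges -bernoulli_mx_meanE.
under eq_bigl => u do rewrite cusum_obs_of_edges.
exact: (opnorm_tail_le edge_prob_01 sqr_cusum_coef_le1 sum_sqr_cusum_coef omega_gt0 cusum_row_le).
Qed.

End Model.
End Cusum.

(** * Choice of the moment order and the tail bound at the threshold *)

Section Tail.
Variable R : realType.

(** The argument is at least 4, and e <= 4 follows from exp(-1/2) >= 1/2. The bound lets additive
    constants be absorbed into multiples of the logarithm. *)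
Lemma ln_2n_ge1 n (delta : R) : (2 <= n)%N -> 0 < delta < 1 -> 1 <= ln (2 * n%:R / delta).
Proof.
move=> n2 /andP[d0 d1]; have n2' : 2 <= n%:R :> R by rewrite ler_nat.
have half : expR (1 / 2) <= 2 :> R.
  have h : 1 / 2 <= expR (- (1 / 2)) :> R by apply: le_trans (expR_ge1Dx _); lra.
  move: h; rewrite expRN -[leRHS]div1r ler_pdivlMr ?expR_gt0//; lra.
have e1 : expR 1 <= 4 :> R.
  have -> : 1 = 2%:R * (1 / 2) :> R by lra.
  rewrite expRM_natl; have := expR_ge0 (1 / 2 : R); nra.
rewrite -[leLHS]expRK ler_ln ?posrE ?expR_gt0 ?divr_gt0 ?mulr_gt0//; last lra.
apply: le_trans e1 _; rewrite ler_pdivlMr//; nra.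
Qed.

(** The exponent is the least even integer above l / ln(1 + eps); rounding costs at most 2, hence at
    most 2l. *)
Lemma pow_exponent (eps l : R) : 0 < eps -> 1 <= l -> exists q : nat,
  expR l <= (1 + eps) ^+ (2 * q.+1) /\ (2 * q.+1)%:R <= ((ln (1 + eps))^-1 + 2) * l.
Proof.
move=> e0 l1; have k0 : 0 < ln (1 + eps) by rewrite ln_gt0// ltrDl.
have x0 : 0 <= l / ln (1 + eps) / 2 by rewrite !divr_ge0// ?(ltW k0)//; lra.
have /andP[lo hi] := trunc_itv x0; exists (Num.trunc (l / ln (1 + eps) / 2)).
move: lo hi; set q := Num.trunc _ => lo hi; split; last first.
  have -> : ((ln (1 + eps))^-1 + 2) * l = l / ln (1 + eps) + 2 * l by ring.
  rewrite natrM -natr1; lra.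
rewrite -[X in X ^+ _](@lnK _ (1 + eps)) ?posrE; last by lra.
rewrite -expRM_natl ler_expR natrM -ler_pdivrMr//; lra.
Qed.

Lemma cusum_tail_threshold (eps : R) : 0 < eps -> exists2 C : R, 0 < C &
  forall n T tau : nat, (2 <= n)%N -> (0 < tau)%N -> (tau < T)%N ->
  forall (Theta : 'I_T -> 'M[R]_n) (P : 'M[R]_n) (omega delta H : R),
  0 < omega -> 0 < delta < 1 -> (forall t, param_set omega (Theta t, P)) ->
  threshold eps C omega delta n <= H ->
  obs_prob Theta P (fun Y => H <= opnorm (cusum Y tau - cusum_mean tau Theta P)) <= delta.
Proof.
move=> e0; have k0 : 0 < ln (1 + eps) by rewrite ln_gt0// ltrDl.
pose K := (ln (1 + eps))^-1 + 2.
have K0 : 0 < K by rewrite addr_gt0// invr_gt0.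
(* Since 1 <= N <= K l, the term 4 (4N + N(N+1)) is at most 24 (K l)^2, which fits under the square
   of 5 K l. *)
exists (5 * (1 + eps) * K); first by rewrite !mulr_gt0//; lra.
move=> n T tau n2 tau0 tauT Theta P omega delta H w0 d01 params thrH.
have l1 := ln_2n_ge1 n2 d01; set l := ln _ in l1.
have /andP[d0 d1] := d01.
have [q [powq Nle]] := pow_exponent e0 l1.
set N := (2 * q.+1)%N in powq Nle; rewrite -/K in Nle.
have N1 : 1 <= N%:R :> R by rewrite ler1n muln_gt0.
have H_gt0 : 0 < H.
  apply: lt_le_trans thrH; rewrite /threshold -/l.
  by rewrite ltr_wpDl// ?mulr_gt0 ?mulr_ge0 ?sqrtr_ge0//; lra.
(* The moment bound then stays a factor (1 + eps)^N below n H^N, and this factor is at least 2n /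
   delta. *)
have key : (1 + eps) ^+ 2 * (4 * (2 * omega + (4 * N + N * N.+1)%:R)) <= H ^+ 2.
  set M : R := (1 + eps) * K * l.
  have M0 : 0 <= M by rewrite !mulr_ge0//; lra.
  apply: (@le_trans _ _ ((1 + eps) ^+ 2 * (8 * omega) + 24 * M ^+ 2)).
    rewrite mulrDr mulrDr lerD//; first by rewrite (_ : 4 * (2 * omega) = 8 * omega)//; ring.
    have -> : 24 * M ^+ 2 = (1 + eps) ^+ 2 * (24 * (K * l) ^+ 2) by rewrite /M; ring.
    rewrite ler_wpM2l ?sqr_ge0//.
    have cast k : (4 * k + k * k.+1)%:R = 4 * k%:R + k%:R * (k%:R + 1) :> R.
      by rewrite natrD !natrM natr1.
    rewrite cast.
    have : N%:R ^+ 2 <= (K * l) ^+ 2 :> R by rewrite lerXn2r ?nnegrE ?mulr_ge0//; lra.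
    nra.
  (* Expanding the square of the threshold, the first square is (1 + eps)^2 times 8 omega and the
     cross term is nonnegative. *)
  apply: (@le_trans _ _ ((2 * Num.sqrt 2 * (1 + eps) * Num.sqrt omega + 5 * M) ^+ 2)).
    have cross : 0 <= 2 * Num.sqrt 2 * (1 + eps) * Num.sqrt omega * M.
      by rewrite !mulr_ge0 ?sqrtr_ge0//; lra.
    have -> : (2 * Num.sqrt 2 * (1 + eps) * Num.sqrt omega + 5 * M) ^+ 2 =
      4 * (Num.sqrt 2 ^+ 2 * Num.sqrt omega ^+ 2) * (1 + eps) ^+ 2
      + 10 * (2 * Num.sqrt 2 * (1 + eps) * Num.sqrt omega * M) + 25 * M ^+ 2 by ring.
    rewrite (@sqr_sqrtr _ 2)// (sqr_sqrtr (ltW w0)).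
    have -> : 4 * (2 * omega) * (1 + eps) ^+ 2 = (1 + eps) ^+ 2 * (8 * omega) by ring.
    have := sqr_ge0 M.
    lra.
  rewrite lerXn2r ?nnegrE ?(ltW H_gt0)//.
    by rewrite addr_ge0// !mulr_ge0 ?sqrtr_ge0//; lra.
  by apply: le_trans thrH; rewrite /threshold -/l /M; lra.
have HN : 0 < H ^+ N by rewrite exprn_gt0.
rewrite -(ler_pM2r HN).
apply: (le_trans (cusum_tail_le tau0 tauT params w0 q (ltW H_gt0))).
have eN : 0 < (1 + eps) ^+ N by rewrite exprn_gt0//; lra.
rewrite -(ler_pM2l eN).
have El : expR l = 2 * n%:R / delta.
  by rewrite lnK// posrE divr_gt0// mulr_gt0// ltr0n (leq_trans _ n2).
rewrite El in powq.
apply: (@le_trans _ _ (n%:R * H ^+ N)).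
  rewrite mulrCA ler_wpM2l// /N exprM -exprMn [leRHS]exprM lerXn2r ?nnegrE ?sqr_ge0//.
  by rewrite mulr_ge0 ?sqr_ge0// mulr_ge0// addr_ge0// mulr_ge0// ltW.
rewrite mulrA (ler_wpM2r (ltW HN))//.
move: powq; rewrite ler_pdivrMr// => powq; apply: le_trans powq.
by rewrite ler_peMl// ler1n.
Qed.

Lemma obs_prob_le n T (Theta : 'I_T -> 'M[R]_n) (P : 'M[R]_n) (E F : pred (obs n T)) :
  (forall t, connection_mx (Theta t)) -> connection_mx P ->
  (forall Y, E Y -> F Y) -> obs_prob Theta P E <= obs_prob Theta P F.
Proof.
move=> hT hP EF; rewrite /obs_prob [leLHS]big_mkcond [leRHS]big_mkcond.
apply: ler_sum => Y _; have := EF Y.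
have : 0 <= \prod_t irgml_pmf (Theta t) P (Y t).
  by apply: prodr_ge0 => t _; exact: irgml_pmf_ge0.
by case: (E Y) => [pr /(_ isT) ->//|]; case: (F Y).
Qed.

(** For empty [A] the supremum is 0, which is where 0 <= x enters. *)
Lemma sup_image_le (S : Type) (A : set S) (f : S -> R) (x : R) : 0 <= x ->
  (forall s, A s -> f s <= x) -> sup [set f s | s in A]%classic <= x.
Proof.
move=> x0 fx; have [->|/set0P[s As]] := eqVneq A set0.
  by rewrite image_set0 sup0.
apply: ge_sup; first by exists (f s), s.
by move=> _ [s' As' <-]; exact: fx.
Qed.

Lemma cusum_mean_const n T tau (Theta P : 'M[R]_n) : (0 < tau)%N -> (tau < T)%N ->
  cusum_mean tau (fun _ : 'I_T => Theta) P = 0.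
Proof.
by move=> tau0 tauT; rewrite /cusum_mean -scaler_suml sum_cusum_coef// scale0r.
Qed.

Lemma cusum_mean_step n T tau (Ta Tb P : 'M[R]_n) : (0 < tau)%N -> (tau < T)%N ->
  cusum_mean tau (fun t : 'I_T => if (t < tau)%N then Ta else Tb) P
  = cusum_scale R T tau *: hadamard P (Ta - Tb).
Proof.
move=> tau0 tauT; apply/matrixP => x y; rewrite summxE.
set k := cusum_scale R T tau.
rewrite (eq_bigr (fun t : 'I_T => if (t < tau)%N then k / tau%:R * (P x y * Ta x y)
    else - (k / (T - tau)%:R) * (P x y * Tb x y))); last first.
  by move=> t _; rewrite !mxE /cusum_coef -/k; case: ifP.
rewrite sum_ord_step 1?ltnW// !mxE.
have tau_neq0 : tau%:R != 0 :> R by rewrite pnatr_eq0 -lt0n.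
have sub_neq0 : (T - tau)%:R != 0 :> R by rewrite pnatr_eq0 -lt0n subn_gt0.
move: tau_neq0 sub_neq0; move: (tau%:R) ((T - tau)%:R) => u v u0 v0.
by field; rewrite u0 v0.
Qed.

End Tail.

(** * The two errors of the CUSUM test *)

Theorem theorem1 (R : realType) (eps : R) (eps_gt0 : 0 < eps)
    (eps_le : eps <= 1 / 2) :
  exists Ceps C : R, [/\ 0 < Ceps, 0 < C &
    forall (n T : nat), (2 <= n)%N -> (2 <= T)%N ->
    forall omega : R, 0 < omega ->
    forall tau : nat, (1 <= tau <= T - 1)%N ->
    forall alpha beta : R, 0 < alpha < 1 -> 0 < beta < 1 ->
    forall r : R,
      r >= 4 * Num.sqrt 2 * (1 + eps) * Num.sqrt (omega / T%:R)
           + C / Num.sqrt T%:R * ln (n%:R / Num.min alpha beta) ->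
    let psi : test n T :=
      cusum_test tau (threshold eps Ceps omega alpha n) in
    typeI_error omega psi <= alpha /\ typeII_error tau omega r psi <= beta].
Proof.
have [C0 C0_gt0 tail] := cusum_tail_threshold eps_gt0.
(* The signal must exceed two thresholds, for alpha and for beta, and each logarithm costs at most 2
   ln(n / min(alpha, beta)). *)
exists C0, (4 * C0); split=> //; first by rewrite mulr_gt0.
move=> n T n2 T2 omega w0 tau /andP[tau0 tauT'] alpha beta a01 b01 r hr psi.
have tauT : (tau < T)%N by rewrite (leq_ltn_trans tauT')// ltn_subrL (leq_trans _ T2).
have /andP[a0 a1] := a01; have /andP[b0 b1] := b01.
split; apply: sup_image_le; rewrite ?(ltW a0) ?(ltW b0)//.
  move=> [Th P] /= params; have [[conT _] [conP _ _] _] := params.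
  apply: le_trans (tail n T tau n2 tau0 tauT (fun=> Th) P omega alpha _ w0 a01
    (fun=> params) (lexx _)).
  apply: obs_prob_le => // Y; rewrite cusum_mean_const// subr0; exact: ltW.
move=> [[Ta Tb] P] /= [paramsa paramsb sep].
have [[conTa _] [conP _ _] _] := paramsa; have [[conTb _] _ _] := paramsb.
have params (t : 'I_T) : param_set omega (if (t < tau)%N then Ta else Tb, P) by case: ifP.
(* Acceptance at the threshold for alpha forces a deviation from the mean above the threshold for
   beta, so the tail bound is used at level beta. *)
apply: le_trans (tail n T tau n2 tau0 tauT _ P omega beta _ w0 b01 params (lexx _)).
apply: obs_prob_le => // [t|Y]; first by case: ifP.
rewrite /psi /cusum_test -leNgt cusum_mean_step// => acc.
set D := hadamard P (Ta - Tb) in sep *.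
have T0 : 0 < Num.sqrt T%:R :> R by rewrite sqrtr_gt0 ltr0n (leq_trans _ T2).
have scale_ge0 : 0 <= cusum_scale R T tau by exact: sqrtr_ge0.
have opD : Num.sqrt T%:R * r <= opnorm (cusum_scale R T tau *: D).
  by rewrite opnormZ ger0_norm// cusum_scaleE// -mulrA ler_wpM2l// ltW.
have triangle : opnorm (cusum_scale R T tau *: D) <=
    opnorm (cusum Y tau) + opnorm (cusum Y tau - cusum_scale R T tau *: D).
  rewrite -[X in opnorm X <= _](subrKC (cusum Y tau)) -opprB -scaleN1r.
  by apply: le_trans (opnormD _ _) _; rewrite lerD2l opnormZ normrN1 mul1r.
set m := Num.min alpha beta in hr.
have m0 : 0 < m by rewrite lt_min a0.
have n_gt0 : 0 < n%:R :> R by rewrite ltr0n (leq_trans _ n2).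
(* Here 2n <= n^2 because n >= 2, and m^2 <= x because m <= x < 1. *)
have log_le (x : R) : 0 < x -> x < 1 -> m <= x ->
    ln (2 * n%:R / x) <= 2 * ln (n%:R / m).
  move=> x0 x1 mx.
  have -> : 2 * ln (n%:R / m) = ln ((n%:R / m) ^+ 2).
    by rewrite lnXn ?divr_gt0// mulr_natl.
  rewrite ler_ln ?posrE ?exprn_gt0 ?divr_gt0 ?mulr_gt0//.
  have n2' : 2 <= n%:R :> R by rewrite ler_nat.
  rewrite expr_div_n ler_pdivrMr// mulrAC ler_pdivlMr ?exprn_gt0//.
  have mm : m ^+ 2 <= x.
    by rewrite expr2 -[leRHS]mulr1 ler_pM ?(ltW m0)// (le_trans mx) ?ltW.
  have nn : 2 * n%:R <= n%:R ^+ 2 :> R by rewrite expr2 ler_wpM2r ?ler0n.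
  by rewrite ler_pM// ?mulr_ge0 ?sqr_ge0// ltW.
have la : ln (2 * n%:R / alpha) <= 2 * ln (n%:R / m) by rewrite log_le// ge_min lexx.
have lb : ln (2 * n%:R / beta) <= 2 * ln (n%:R / m) by rewrite log_le// ge_min lexx orbT.
have hr' : 4 * Num.sqrt 2 * (1 + eps) * Num.sqrt omega + 4 * C0 * ln (n%:R / m)
    <= Num.sqrt T%:R * r.
  apply: le_trans (ler_wpM2l (ltW T0) hr).
  rewrite sqrtrM ?(ltW w0)// sqrtrV ?ler0n//.
  rewrite le_eqVlt; apply/orP; left; apply/eqP; field.
  by rewrite gt_eqF.
rewrite /threshold in acc *.
move: (ler_wpM2l (ltW C0_gt0) la) (ler_wpM2l (ltW C0_gt0) lb) acc opD triangle hr'.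
clear; lra.
Qed.
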